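(* Let $F$ be a field, let $n\ge 2$, and let $(\theta,\phi) \in \mathrm{Aut}\big(L_{n,2}^{(1)}\big) \times \mathrm{Aut}\big(L_{n,2}^{ab}\big)$. If $[\theta]=(b_{i,j;k,l})$ and $[\phi]=(a_{ij})$ are the corresponding matrices, then the pair $(\theta, \phi)$ is inducible if and only if $$a_{ik}a_{jl}- a_{il}a_{jk} =b_{i,j; k,l}\quad\text{for all } 1 \leq j <i \leq n \text{ and } 1 \leq l <k \leq n.$$
   Context: $L_{n,2}=\langle x_1,\dots,x_n \mid [[x_i,x_j],x_k]=0 \text{ for all } 1\le i,j,k\le n\rangle$ is the free nilpotent Lie algebra over $F$ of rank $n$ and step $2$. Its derived subalgebra $L_{n,2}^{(1)}=[L_{n,2},L_{n,2}]$ is abelian with $F$-basis $z_{i,j}=[x_i,x_j]$, $1\le j<i\le n$. The abelianization $L_{n,2}^{ab}=L_{n,2}/L_{n,2}^{(1)}$ is abelian with $F$-basis $\overline{x}_1,\dots,\overline{x}_n$ (the images of the $x_i$). $\mathrm{Aut}(\cdot)$ denotes the group of Lie algebra automorphisms. The matrix entries are defined by $\theta(z_{i,j})=\sum_{1\le l<k\le n} b_{i,j;k,l}\,z_{k,l}$ and $\phi(\overline{x}_i)=\sum_{k=1}^n a_{ik}\overline{x}_k$. The pair $(\theta,\phi)$ is inducible if there is a Lie algebra automorphism $\gamma$ of $L_{n,2}$ (with $\gamma(L_{n,2}^{(1)})=L_{n,2}^{(1)}$) whose restriction to $L_{n,2}^{(1)}$ is $\theta$ and whose induced automorphism of $L_{n,2}^{ab}$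 is $\phi$. *)

(* Defs.v *)
From HB Require Import structures.
From mathcomp Require Import all_boot all_order all_algebra.
From mathcomp Require Import boolp.

Set Implicit Arguments.
Unset Strict Implicit.
Unset Printing Implicit Defensive.

Import GRing.Theory.
Local Open Scope ring_scope.
Local Open Scope quotient_scope.

HB.mixin Record Lmodule_isLie (F : fieldType) L of GRing.Lmodule F L := {
  lieb : L -> L -> L;
  lieb_linearl : forall z, linear (fun x => lieb x z);
  lieb_linearr : forall x, linear (lieb x);
  lieb_alt : forall x, lieb x x = 0;
  lieb_jacobi : forall x y z,
    lieb x (lieb y z) + lieb y (lieb z x) + lieb z (lieb x y) = 0
}.

#[short(type="lieAlgType")]
HB.structure Definition LieAlgebra (F : fieldType) :=
  {L of Lmodule_isLie F L & GRing.Lmodule F L}.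

Notation "[[ x , y ]]" := (lieb x y)
  (at level 0, x, y at level 99, format "[[ x ,  y ]]") : ring_scope.

Definition lie_morphism (F : fieldType) (L M : lieAlgType F) (f : L -> M) :=
  linear f /\ {morph f : x y / [[x, y]] >-> [[x, y]]}.

Record lieAut (F : fieldType) (L : lieAlgType F) := LieAut {
  lieAut_fun :> L -> L;
  lieAut_morphism : lie_morphism lieAut_fun;
  lieAut_bij : bijective lieAut_fun
}.

Section BracketTheory.
Variables (F : fieldType) (L : lieAlgType F).
Implicit Types x y z : L.

Lemma liebDl x y z : [[x + y, z]] = [[x, z]] + [[y, z]].
Proof. by have := lieb_linearl z 1 x y; rewrite !scale1r. Qed.

Lemma liebDr x y z : [[x, y + z]] = [[x, y]] + [[x, z]].
Proof. by have := lieb_linearr x 1 y z; rewrite !scale1r. Qed.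

Lemma lieb0l z : [[0 : L, z]] = 0.
Proof. by apply: (addrI [[0, z]]); rewrite -liebDl !addr0. Qed.

Lemma lieb0r z : [[z, 0 : L]] = 0.
Proof. by apply: (addrI [[z, 0]]); rewrite -liebDr !addr0. Qed.

Lemma liebZl c x z : [[c *: x, z]] = c *: [[x, z]].
Proof. by have := lieb_linearl z c x 0; rewrite lieb0l !addr0. Qed.

Lemma liebZr c x z : [[z, c *: x]] = c *: [[z, x]].
Proof. by have := lieb_linearr z c x 0; rewrite lieb0r !addr0. Qed.

Lemma liebBl x y z : [[x - y, z]] = [[x, z]] - [[y, z]].
Proof. by rewrite -scaleN1r liebDl liebZl scaleN1r. Qed.

Lemma liebBr x y z : [[z, x - y]] = [[z, x]] - [[z, y]].
Proof. by rewrite -scaleN1r liebDr liebZr scaleN1r. Qed.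

End BracketTheory.

Section Derived.
Variables (F : fieldType) (L : lieAlgType F).

Definition derived_pred : {pred L} := fun x =>
  `[< exists s : seq (F * (L * L)), x = \sum_(p <- s) p.1 *: [[p.2.1, p.2.2]] >].

Lemma derived_submod_closed : submod_closed derived_pred.
Proof.
split; first by apply/asboolP; exists [::]; rewrite big_nil.
move=> c x y /asboolP[s ->] /asboolP[t ->]; apply/asboolP.
exists ([seq (c * p.1, p.2) | p <- s] ++ t).
rewrite big_cat big_map /= scaler_sumr; congr (_ + _).
by apply: eq_bigr => p _; rewrite scalerA.
Qed.

HB.instance Definition _ :=
  GRing.isSubmodClosed.Build F L derived_pred derived_submod_closed.

Lemma lieb_derived (x y : L) : [[x, y]] \in derived_pred.
Proof.
by apply/asboolP; exists [:: (1, (x, y))]; rewrite big_seq1 scale1r.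
Qed.

Record derived := Derived {
  derived_val : L;
  _ : derived_val \in derived_pred
}.

HB.instance Definition _ := [isSub for derived_val].
HB.instance Definition _ := [Choice of derived by <:].
HB.instance Definition _ := [SubChoice_isSubLmodule of derived by <:].

Definition derived_bracket (x y : L) : derived := Derived (lieb_derived x y).

Definition derived_lieb (u v : derived) : derived :=
  derived_bracket (val u) (val v).

Fact derived_lieb_linearl z : linear (fun x => derived_lieb x z).
Proof. by move=> c x y; apply: val_inj; rewrite /= liebDl liebZl. Qed.

Fact derived_lieb_linearr x : linear (derived_lieb x).
Proof. by move=> c y z; apply: val_inj; rewrite /= liebDr liebZr. Qed.

Fact derived_lieb_alt x : derived_lieb x x = 0.
Proof. by apply: val_inj; rewrite /= lieb_alt. Qed.

Fact derived_lieb_jacobi x y z :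
  derived_lieb x (derived_lieb y z) + derived_lieb y (derived_lieb z x)
    + derived_lieb z (derived_lieb x y) = 0.
Proof. by apply: val_inj; rewrite /= lieb_jacobi. Qed.

HB.instance Definition _ := Lmodule_isLie.Build F derived
  derived_lieb_linearl derived_lieb_linearr derived_lieb_alt
  derived_lieb_jacobi.

End Derived.

Section Abelianization.
Variables (F : fieldType) (L : lieAlgType F).

Local Notation Q := (Quotient.quot (@derived_pred F L)).

Definition abelianization : Type := Q.
HB.instance Definition _ := GRing.Zmodule.on abelianization.

Definition ab (x : L) : abelianization := \pi_Q x.

Lemma ab_eq x y : (ab x = ab y) <-> (x - y \in @derived_pred F L).
Proof. by rewrite Quotient.idealrBE; split=> /eqP. Qed.

Lemma abD : {morph ab : x y / x + y}.
Proof. exact: Quotient.pi_add. Qed.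

Definition ab_repr (u : abelianization) : L := repr (u : Q).

Lemma ab_reprK u : ab (ab_repr u) = u.
Proof. exact: reprK. Qed.

Definition ab_scale (c : F) (u : abelianization) := ab (c *: ab_repr u).
Definition ab_lieb (u v : abelianization) := ab [[ab_repr u, ab_repr v]].

Lemma ab_scaleE c x : ab_scale c (ab x) = ab (c *: x).
Proof. by apply/ab_eq; rewrite -scalerBr rpredZ //; apply/ab_eq/ab_reprK. Qed.

Lemma ab_liebE x y : ab_lieb (ab x) (ab y) = ab [[x, y]].
Proof. by apply/ab_eq; rewrite rpredB ?lieb_derived. Qed.

Lemma abP (P : abelianization -> Prop) : (forall x, P (ab x)) -> forall u, P u.
Proof. by move=> Pab u; rewrite -[u]ab_reprK. Qed.

Fact ab_scaleA c d u : ab_scale c (ab_scale d u) = ab_scale (c * d) u.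
Proof. by elim/abP: u => x; rewrite !ab_scaleE scalerA. Qed.

Fact ab_scale1 : left_id 1 ab_scale.
Proof. by elim/abP=> x; rewrite ab_scaleE scale1r. Qed.

Fact ab_scaleDr : right_distributive ab_scale +%R.
Proof.
move=> c; elim/abP=> x; elim/abP=> y.
by rewrite !(ab_scaleE, =^~ abD) scalerDr.
Qed.

Fact ab_scaleDl u : {morph ab_scale^~ u : c d / c + d}.
Proof. by elim/abP: u => x c d; rewrite !(ab_scaleE, =^~ abD) scalerDl. Qed.

HB.instance Definition _ := GRing.Zmodule_isLmodule.Build F abelianization
  ab_scaleA ab_scale1 ab_scaleDr ab_scaleDl.

Lemma abZ c x : ab (c *: x) = c *: ab x.
Proof. by rewrite -[LHS]ab_scaleE. Qed.

Lemma ab0 : ab 0 = 0.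
Proof. by rewrite -(scale0r (ab 0)) -abZ scale0r. Qed.

Fact ab_lieb_linearl w : linear (fun u => ab_lieb u w).
Proof.
elim/abP: w => z c; elim/abP=> x; elim/abP=> y.
by rewrite -abZ -abD !ab_liebE -abZ -abD liebDl liebZl.
Qed.

Fact ab_lieb_linearr w : linear (ab_lieb w).
Proof.
elim/abP: w => z c; elim/abP=> x; elim/abP=> y.
by rewrite -abZ -abD !ab_liebE -abZ -abD liebDr liebZr.
Qed.

Fact ab_lieb_alt u : ab_lieb u u = 0.
Proof. by elim/abP: u => x; rewrite ab_liebE lieb_alt ab0. Qed.

Fact ab_lieb_jacobi u v w :
  ab_lieb u (ab_lieb v w) + ab_lieb v (ab_lieb w u)
    + ab_lieb w (ab_lieb u v) = 0.
Proof.
elim/abP: u => x; elim/abP: v => y; elim/abP: w => z.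
by rewrite !ab_liebE -!abD lieb_jacobi ab0.
Qed.

HB.instance Definition _ := Lmodule_isLie.Build F abelianization
  ab_lieb_linearl ab_lieb_linearr ab_lieb_alt ab_lieb_jacobi.

Lemma ab_morphism : lie_morphism ab.
Proof.
by split=> [c x y|x y]; [rewrite abD abZ | rewrite -[LHS]ab_liebE].
Qed.

End Abelianization.

(* Lie algebras given by n generators and relators: formal Lie expressions    *)
(* modulo the least congruence containing the Lie algebra laws and the        *)
(* relators.                                                                  *)
Inductive lie_term (F : fieldType) (n : nat) : Type :=
  | TGen of 'I_n
  | TZero
  | TOpp of lie_term F n
  | TAdd of lie_term F n & lie_term F n
  | TScale of F & lie_term F n
  | TBr of lie_term F n & lie_term F n.
Arguments TGen {F n}.
Arguments TZero {F n}.

Section Presentation.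
Variables (F : fieldType) (n : nat) (rel : lie_term F n -> Prop).
Local Notation T := (lie_term F n).

Inductive pres_eq : T -> T -> Prop :=
  | PE_refl x : pres_eq x x
  | PE_sym x y : pres_eq x y -> pres_eq y x
  | PE_trans y x z : pres_eq x y -> pres_eq y z -> pres_eq x z
  | PE_opp x x' : pres_eq x x' -> pres_eq (TOpp x) (TOpp x')
  | PE_add x x' y y' : pres_eq x x' -> pres_eq y y' ->
      pres_eq (TAdd x y) (TAdd x' y')
  | PE_scale c x x' : pres_eq x x' -> pres_eq (TScale c x) (TScale c x')
  | PE_br x x' y y' : pres_eq x x' -> pres_eq y y' ->
      pres_eq (TBr x y) (TBr x' y')
  | PE_addA x y z : pres_eq (TAdd x (TAdd y z)) (TAdd (TAdd x y) z)
  | PE_addC x y : pres_eq (TAdd x y) (TAdd y x)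
  | PE_add0 x : pres_eq (TAdd TZero x) x
  | PE_addN x : pres_eq (TAdd (TOpp x) x) TZero
  | PE_scaleA c d x : pres_eq (TScale c (TScale d x)) (TScale (c * d) x)
  | PE_scale1 x : pres_eq (TScale 1 x) x
  | PE_scaleDr c x y :
      pres_eq (TScale c (TAdd x y)) (TAdd (TScale c x) (TScale c y))
  | PE_scaleDl c d x :
      pres_eq (TScale (c + d) x) (TAdd (TScale c x) (TScale d x))
  | PE_brl c x y z :
      pres_eq (TBr (TAdd (TScale c x) y) z) (TAdd (TScale c (TBr x z)) (TBr y z))
  | PE_brr c x y z :
      pres_eq (TBr z (TAdd (TScale c x) y)) (TAdd (TScale c (TBr z x)) (TBr z y))
  | PE_alt x : pres_eq (TBr x x) TZero
  | PE_jacobi x y z :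
      pres_eq (TAdd (TAdd (TBr x (TBr y z)) (TBr y (TBr z x))) (TBr z (TBr x y)))
              TZero
  | PE_rel x : rel x -> pres_eq x TZero.

HB.instance Definition _ := gen_eqMixin T.
HB.instance Definition _ := gen_choiceMixin T.

Definition pres_eqb (x y : T) : bool := `[< pres_eq x y >].

Fact pres_eqb_equiv : equiv_class_of pres_eqb.
Proof.
split=> [x|x y|y x z]; first exact/asboolP/PE_refl.
  by apply/asboolP/asboolP; apply: PE_sym.
by move=> /asboolP xy /asboolP yz; apply/asboolP; apply: PE_trans xy yz.
Qed.

Canonical pres_eqb_equivRel := EquivRelPack pres_eqb_equiv.
Canonical pres_eqb_encModRel := defaultEncModRel pres_eqb.

Definition presLie : Type := {eq_quot pres_eqb}.
HB.instance Definition _ := Choice.on presLie.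

Definition pres_class (t : T) : presLie := \pi_({eq_quot pres_eqb}) t.
Definition pres_repr (u : presLie) : T := repr (u : {eq_quot pres_eqb}).
Definition pres_gen (i : 'I_n) : presLie := pres_class (TGen i).

Lemma pres_classP x y : (pres_class x = pres_class y) <-> pres_eq x y.
Proof.
split=> [/eqmodP/asboolP //|exy].
by apply/eqmodP/asboolP.
Qed.

Lemma pres_reprK u : pres_class (pres_repr u) = u.
Proof. exact: reprK. Qed.

Lemma presP (P : presLie -> Prop) : (forall t, P (pres_class t)) -> forall u, P u.
Proof. by move=> Pc u; rewrite -[u]pres_reprK. Qed.

Lemma pres_repr_eq t : pres_eq (pres_repr (pres_class t)) t.
Proof. exact/pres_classP/pres_reprK. Qed.

Definition pres_opp u := pres_class (TOpp (pres_repr u)).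
Definition pres_add u v := pres_class (TAdd (pres_repr u) (pres_repr v)).
Definition pres_scale c u := pres_class (TScale c (pres_repr u)).
Definition pres_lieb u v := pres_class (TBr (pres_repr u) (pres_repr v)).

Lemma pres_oppE t : pres_opp (pres_class t) = pres_class (TOpp t).
Proof. by apply/pres_classP/PE_opp/pres_repr_eq. Qed.

Lemma pres_addE s t :
  pres_add (pres_class s) (pres_class t) = pres_class (TAdd s t).
Proof. by apply/pres_classP/PE_add; apply: pres_repr_eq. Qed.

Lemma pres_scaleE c t : pres_scale c (pres_class t) = pres_class (TScale c t).
Proof. by apply/pres_classP/PE_scale/pres_repr_eq. Qed.

Lemma pres_liebE s t :
  pres_lieb (pres_class s) (pres_class t) = pres_class (TBr s t).
Proof. by apply/pres_classP/PE_br; apply: pres_repr_eq. Qed.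

Let presE := (pres_oppE, pres_addE, pres_scaleE, pres_liebE).

Fact pres_addA : associative pres_add.
Proof.
elim/presP=> x; elim/presP=> y; elim/presP=> z.
by rewrite !presE; apply/pres_classP/PE_addA.
Qed.

Fact pres_addC : commutative pres_add.
Proof.
by elim/presP=> x; elim/presP=> y; rewrite !presE; apply/pres_classP/PE_addC.
Qed.

Fact pres_add0 : left_id (pres_class TZero) pres_add.
Proof. by elim/presP=> x; rewrite !presE; apply/pres_classP/PE_add0. Qed.

Fact pres_addN : left_inverse (pres_class TZero) pres_opp pres_add.
Proof. by elim/presP=> x; rewrite !presE; apply/pres_classP/PE_addN. Qed.

HB.instance Definition _ :=
  GRing.isZmodule.Build presLie pres_addA pres_addC pres_add0 pres_addN.

Fact pres_scaleA c d u : pres_scale c (pres_scale d u) = pres_scale (c * d) u.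
Proof. by elim/presP: u => x; rewrite !presE; apply/pres_classP/PE_scaleA. Qed.

Fact pres_scale1 : left_id 1 pres_scale.
Proof. by elim/presP=> x; rewrite !presE; apply/pres_classP/PE_scale1. Qed.

Fact pres_scaleDr : right_distributive pres_scale +%R.
Proof.
move=> c; elim/presP=> x; elim/presP=> y; rewrite /GRing.add /= !presE.
exact/pres_classP/PE_scaleDr.
Qed.

Fact pres_scaleDl u : {morph pres_scale^~ u : c d / c + d}.
Proof.
elim/presP: u => x c d; rewrite {2}/GRing.add /= !presE.
exact/pres_classP/PE_scaleDl.
Qed.

HB.instance Definition _ := GRing.Zmodule_isLmodule.Build F presLie
  pres_scaleA pres_scale1 pres_scaleDr pres_scaleDl.

Lemma pres_class0 : pres_class TZero = 0.
Proof. by []. Qed.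

Lemma pres_classN x : pres_class (TOpp x) = - pres_class x.
Proof. by rewrite -[LHS]pres_oppE. Qed.

Lemma pres_classD x y : pres_class (TAdd x y) = pres_class x + pres_class y.
Proof. by rewrite -[LHS]pres_addE. Qed.

Lemma pres_classZ c x : pres_class (TScale c x) = c *: pres_class x.
Proof. by rewrite -[LHS]pres_scaleE. Qed.

Fact pres_lieb_linearl w : linear (fun u => pres_lieb u w).
Proof.
elim/presP: w => z c; elim/presP=> x; elim/presP=> y.
rewrite -pres_classZ -pres_classD !presE -pres_classZ -pres_classD.
exact/pres_classP/PE_brl.
Qed.

Fact pres_lieb_linearr w : linear (pres_lieb w).
Proof.
elim/presP: w => z c; elim/presP=> x; elim/presP=> y.
rewrite -pres_classZ -pres_classD !presE -pres_classZ -pres_classD.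
exact/pres_classP/PE_brr.
Qed.

Fact pres_lieb_alt u : pres_lieb u u = 0.
Proof. by elim/presP: u => x; rewrite presE; apply/pres_classP/PE_alt. Qed.

Fact pres_lieb_jacobi u v w :
  pres_lieb u (pres_lieb v w) + pres_lieb v (pres_lieb w u)
    + pres_lieb w (pres_lieb u v) = 0.
Proof.
elim/presP: u => x; elim/presP: v => y; elim/presP: w => z.
rewrite !presE -!pres_classD; exact/pres_classP/PE_jacobi.
Qed.

HB.instance Definition _ := Lmodule_isLie.Build F presLie
  pres_lieb_linearl pres_lieb_linearr pres_lieb_alt pres_lieb_jacobi.

Lemma pres_class_lieb x y : pres_class (TBr x y) = [[pres_class x, pres_class y]].
Proof. by rewrite -[LHS]pres_liebE. Qed.

Section Lift.
Variables (M : lieAlgType F) (y : 'I_n -> M).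

Fixpoint term_eval (t : T) : M :=
  match t with
  | TGen i => y i
  | TZero => 0
  | TOpp s => - term_eval s
  | TAdd s t => term_eval s + term_eval t
  | TScale c s => c *: term_eval s
  | TBr s t => [[term_eval s, term_eval t]]
  end.

Hypothesis y_rel : forall t, rel t -> term_eval t = 0.

Lemma term_eval_eq s t : pres_eq s t -> term_eval s = term_eval t.
Proof.
elim=> //=.
- by move=> ? ? ? _ -> _ ->.
- by move=> ? ? _ ->.
- by move=> ? ? ? ? _ -> _ ->.
- by move=> ? ? ? _ ->.
- by move=> ? ? ? ? _ -> _ ->.
- by move=> *; rewrite addrA.
- by move=> *; rewrite addrC.
- by move=> *; rewrite add0r.
- by move=> *; rewrite addNr.
- by move=> *; rewrite scalerA.
- by move=> *; rewrite scale1r.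
- by move=> *; rewrite scalerDr.
- by move=> *; rewrite scalerDl.
- by move=> *; rewrite liebDl liebZl.
- by move=> *; rewrite liebDr liebZr.
- by move=> *; rewrite lieb_alt.
- by move=> *; rewrite lieb_jacobi.
Qed.

Definition pres_lift (u : presLie) : M := term_eval (pres_repr u).

Lemma pres_liftE t : pres_lift (pres_class t) = term_eval t.
Proof. exact/term_eval_eq/pres_repr_eq. Qed.

Lemma pres_lift_gen i : pres_lift (pres_gen i) = y i.
Proof. exact: pres_liftE. Qed.

Lemma pres_lift_morphism : lie_morphism pres_lift.
Proof.
split=> [c|]; elim/presP=> s; elim/presP=> t.
  by rewrite -pres_classZ -pres_classD !pres_liftE.
by rewrite -pres_class_lieb !pres_liftE.
Qed.

Lemma pres_lift_unique (f : presLie -> M) :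
  lie_morphism f -> (forall i, f (pres_gen i) = y i) -> f =1 pres_lift.
Proof.
move=> [flin fbr] fgen; elim/presP=> t; rewrite pres_liftE.
have f0 : f 0 = 0.
  have := flin 1 0 0; rewrite !scale1r !addr0 => e.
  by apply: (addrI (f 0)); rewrite -e addr0.
have fZ c u : f (c *: u) = c *: f u.
  by have := flin c u 0; rewrite f0 !addr0.
have fD u v : f (u + v) = f u + f v.
  by have := flin 1 u v; rewrite !scale1r.
elim: t => /= [i||s IHs|s IHs t IHt|c s IHs|s IHs t IHt].
- exact: fgen.
- exact: f0.
- by rewrite pres_classN -scaleN1r fZ IHs scaleN1r.
- by rewrite pres_classD fD IHs IHt.
- by rewrite pres_classZ fZ IHs.
- by rewrite pres_class_lieb fbr IHs IHt.
Qed.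

End Lift.
End Presentation.

Definition nilp2_rel (F : fieldType) (n : nat) (t : lie_term F n) : Prop :=
  exists i j k : 'I_n, t = TBr (TBr (TGen i) (TGen j)) (TGen k).

Definition freeNilLie2 (F : fieldType) (n : nat) : lieAlgType F :=
  presLie (@nilp2_rel F n).

Section FreeNilpotent.
Variables (F : fieldType) (n : nat).
Local Notation L := (freeNilLie2 F n).

Definition nilp2_gen (i : 'I_n) : L := pres_gen _ i.

Definition nilp2_z (i j : 'I_n) : derived L :=
  derived_bracket (nilp2_gen i) (nilp2_gen j).

(* [b i j k l] is the matrix entry with row index (i, j) and column index     *)
(* (k, l); entries are only meaningful for j < i and l < k.                   *)
Definition derived_matrix (theta : derived L -> derived L)
    (b : 'I_n -> 'I_n -> 'I_n -> 'I_n -> F) : Prop :=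
  forall i j : 'I_n, (j < i)%N ->
    theta (nilp2_z i j) =
      \sum_(k < n) \sum_(l < n | (l < k)%N) b i j k l *: nilp2_z k l.

(* Row convention: row i of [a] holds the coordinates of the image of the     *)
(* i-th basis vector.                                                         *)
Definition ab_matrix (phi : abelianization L -> abelianization L)
    (a : 'M[F]_n) : Prop :=
  forall i : 'I_n, phi (ab (nilp2_gen i)) = \sum_(k < n) a i k *: ab (nilp2_gen k).

End FreeNilpotent.

Definition inducible (F : fieldType) (L : lieAlgType F)
    (theta : lieAut (derived L)) (phi : lieAut (abelianization L)) : Prop :=
  exists gamma : lieAut L,
    [/\ forall y, y \in @derived_pred F L <->
          exists2 x, x \in @derived_pred F L & gamma x = y,
        forall u : derived L, gamma (val u) = val (theta u)
      & forall x : L, ab (gamma x) = phi (ab x)].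

(* Main.v *)
Require Import Defs.
From HB Require Import structures.
From mathcomp Require Import all_boot all_order all_algebra.
From mathcomp Require Import boolp.

Set Implicit Arguments.
Unset Strict Implicit.
Unset Printing Implicit Defensive.

Import GRing.Theory.
Local Open Scope ring_scope.

(** Triple brackets vanish in the free 2-step nilpotent algebra, so a bracket
    depends only on the classes of its arguments in the abelianization, and
    expands on the [z_(k,l)] with the 2 x 2 minors of the coordinates.  This
    determines the restriction of an automorphism to the derived subalgebra
    from the map it induces on the abelianization; the [z_(k,l)], [l < k], are
    linearly independent because they are so in the model
    ['rV_n * 'M_n] with bracket [(u, A), (v, B) |-> (0, u^T v - v^T u)].
    Conversely the condition makes the lift of [x_i |-> \sum_k a_ik x_k] induce
    both [theta] and [phi], and it is bijective since they are. *)

(** * Identities valid in every Lie algebra *)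

HB.instance Definition _ (F : fieldType) (L : lieAlgType F) :=
  GRing.isLinear.Build F L (abelianization L) _ (@ab F L)
    (proj1 (ab_morphism L)).

Section LieAlgebra.
Variables (F : fieldType) (L : lieAlgType F).
Implicit Types x y z : L.

Lemma lieb_antisym x y : [[x, y]] = - [[y, x]].
Proof.
have := lieb_alt (x + y); rewrite liebDl !liebDr !lieb_alt add0r addr0.
by move/eqP; rewrite addr_eq0 => /eqP.
Qed.

(** Bracketing with [x] is a derivation; this form of the Jacobi identity suits inductions on
    brackets. *)
Lemma liebb_jacobi x y z : [[x, [[y, z]]]] = [[ [[x, y]], z]] + [[y, [[x, z]]]].
Proof.
have /eqP := lieb_jacobi x y z; rewrite -addrA addr_eq0 => /eqP ->.
rewrite opprD addrC -(lieb_antisym _ z) (lieb_antisym z x).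
by rewrite -(scaleN1r [[x, z]]) liebZr scaleN1r opprK.
Qed.

Lemma lieb_suml I (r : seq I) (P : pred I) (f : I -> L) z :
  [[\sum_(i <- r | P i) f i, z]] = \sum_(i <- r | P i) [[f i, z]].
Proof.
by apply: (big_morph (fun x => [[x, z]])) => [x y|]; rewrite (liebDl, lieb0l).
Qed.

Lemma lieb_sumr I (r : seq I) (P : pred I) (f : I -> L) z :
  [[z, \sum_(i <- r | P i) f i]] = \sum_(i <- r | P i) [[z, f i]].
Proof.
by apply: (big_morph (fun x => [[z, x]])) => [x y|]; rewrite (liebDr, lieb0r).
Qed.

(** Diagonal terms vanish, and antisymmetry folds each term with [k < l] onto its transpose, which
    produces the minors. *)
Lemma lieb_comb n (g : 'I_n -> L) (a b : 'I_n -> F) :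
  [[\sum_(k < n) a k *: g k, \sum_(l < n) b l *: g l]] =
    \sum_(k < n) \sum_(l < n | (l < k)%N) (a k * b l - a l * b k) *: [[g k, g l]].
Proof.
pose t k l : L := (a k * b l) *: [[g k, g l]].
transitivity (\sum_k \sum_l t k l).
  rewrite lieb_suml; apply: eq_bigr => k _; rewrite lieb_sumr.
  by apply: eq_bigr => l _; rewrite liebZl liebZr scalerA.
transitivity (\sum_(k < n) (\sum_(l < n | (l < k)%N) t k l +
                            \sum_(l < n | (k < l)%N) t k l)).
  apply: eq_bigr => k _; rewrite (bigID (fun l : 'I_n => (l < k)%N)) /=.
  congr (_ + _); rewrite (bigD1 k) ?ltnn //= /t lieb_alt scaler0 add0r.
  by apply: eq_bigl => l; rewrite -leqNgt ltn_neqAle eq_sym andbC.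
rewrite big_split /= [X in _ + X](exchange_big_dep xpredT) //= -big_split /=.
apply: eq_bigr => k _; rewrite -big_split; apply: eq_bigr => l lk /=.
by rewrite /t scalerBl; congr (_ + _); rewrite lieb_antisym scalerN.
Qed.

Lemma ab_lieb_eq0 (u v : abelianization L) : [[u, v]] = 0.
Proof.
elim/abP: u => x; elim/abP: v => y; rewrite -(proj2 (ab_morphism L)).
by rewrite -(ab0 L); apply/ab_eq; rewrite subr0 lieb_derived.
Qed.

Lemma derived_bracket_ind (P : derived L -> Prop) :
  P 0 -> (forall c u v, P u -> P v -> P (c *: u + v)) ->
  (forall x y, P (derived_bracket x y)) -> forall u, P u.
Proof.
move=> P0 PD Pb u; have /asboolP[s def_u] := valP u.
have{def_u} ->: u = \sum_(p <- s) p.1 *: derived_bracket p.2.1 p.2.2.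
  by apply: val_inj; rewrite def_u raddf_sum.
by elim: s => [|p s IHs]; rewrite ?big_nil // big_cons; apply: PD.
Qed.

End LieAlgebra.

(** * A concrete 2-step nilpotent Lie algebra *)

Section WedgeModel.
Variables (F : fieldType) (n : nat).

(** The matrix part houses the exterior square of the row space; admitting all matrices there, not
    only alternating ones, avoids a subtype. *)
Definition wedge_model : Type := ('rV[F]_n * 'M[F]_n)%type.
HB.instance Definition _ := GRing.Lmodule.on wedge_model.

Definition wedge_lieb (p q : wedge_model) : wedge_model :=
  (0, p.1^T *m q.1 - q.1^T *m p.1).

Fact wedge_lieb_linearl q : linear (fun p => wedge_lieb p q).
Proof.
move=> c p p'; congr (_, _); first by rewrite /= scaler0 addr0.
rewrite /= [(_ + _)^T]linearP mulmxDl mulmxDr -scalemxAl -scalemxAr.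
by rewrite scalerBr opprD addrACA.
Qed.

Fact wedge_lieb_linearr p : linear (wedge_lieb p).
Proof.
move=> c q q'; congr (_, _); first by rewrite /= scaler0 addr0.
rewrite /= [(_ + _)^T]linearP mulmxDl mulmxDr -scalemxAl -scalemxAr.
by rewrite scalerBr opprD addrACA.
Qed.

Fact wedge_lieb_alt p : wedge_lieb p p = 0.
Proof. by rewrite /wedge_lieb subrr. Qed.

Lemma wedge_liebb_eq0 p q r : wedge_lieb p (wedge_lieb q r) = 0.
Proof. by rewrite /wedge_lieb /= trmx0 mulmx0 mul0mx subr0. Qed.

Fact wedge_lieb_jacobi p q r :
  wedge_lieb p (wedge_lieb q r) + wedge_lieb q (wedge_lieb r p)
    + wedge_lieb r (wedge_lieb p q) = 0.
Proof. by rewrite !wedge_liebb_eq0 !addr0. Qed.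

HB.instance Definition _ := Lmodule_isLie.Build F wedge_model
  wedge_lieb_linearl wedge_lieb_linearr wedge_lieb_alt wedge_lieb_jacobi.

Definition wedge_gen (i : 'I_n) : wedge_model := (delta_mx 0 i, 0).

Lemma wedge_gen_lieb i j :
  [[wedge_gen i, wedge_gen j]] = (0, delta_mx i j - delta_mx j i).
Proof. by congr (_, _); rewrite /= !trmx_delta !mul_delta_mx. Qed.

Lemma wedge_gen_rel t : nilp2_rel t -> term_eval wedge_gen t = 0.
Proof.
by case=> i [j [k ->] ]; rewrite /= lieb_antisym [X in - X]wedge_liebb_eq0 oppr0.
Qed.

End WedgeModel.

(** * Structure of the free nilpotent algebra of step 2 *)

Section FreeNilpotent.
Variables (F : fieldType) (n : nat).
Local Notation L := (freeNilLie2 F n).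
Local Notation x_ := (@nilp2_gen F n).

Lemma nilp2_ind (P : L -> Prop) :
  (forall i, P (x_ i)) -> P 0 ->
  (forall c u v, P u -> P v -> P (c *: u + v)) ->
  (forall u v, P u -> P v -> P [[u, v]]) -> forall u, P u.
Proof.
move=> Pgen P0 PD Pb; have PZ c u : P u -> P (c *: u).
  by move=> Pu; rewrite -[_ *: _]addr0; apply: PD.
elim/presP; elim=> [i||s Ps|s Ps t Pt|c s Ps|s Ps t Pt].
- exact: Pgen.
- exact: P0.
- by rewrite pres_classN -scaleN1r; apply: PZ.
- by rewrite pres_classD -[pres_class _ s]scale1r; apply: PD.
- by rewrite pres_classZ; apply: PZ.
- by rewrite pres_class_lieb; apply: Pb.
Qed.

(** The relators only kill triple brackets of generators. Induction frees the third argument, then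
    the second, then the first; the derivation identity settles the bracket cases of the first two
    rounds. *)
Lemma nilp2_liebb_eq0 (x y z : L) : [[ [[x, y]], z]] = 0.
Proof.
have gen0 i j w : [[ [[x_ i, x_ j]], w]] = 0.
  elim/nilp2_ind: w => [k||c u v IHu IHv|u v IHu IHv].
  - transitivity (pres_class (@nilp2_rel F n)
                    (TBr (TBr (TGen i) (TGen j)) (TGen k))).
      by rewrite !pres_class_lieb.
    by apply/pres_classP; apply: PE_rel; exists i, j, k.
  - exact: lieb0r.
  - by rewrite liebDr liebZr IHu IHv scaler0 addr0.
  - by rewrite liebb_jacobi IHu IHv lieb0l lieb0r addr0.
have genl0 i v w : [[ [[x_ i, v]], w]] = 0.
  elim/nilp2_ind: v w => [k||c u v IHu IHv|u v IHu IHv] w.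
  - exact: gen0.
  - by rewrite lieb0r lieb0l.
  - by rewrite liebDr liebZr liebDl liebZl IHu IHv scaler0 addr0.
  - by rewrite liebb_jacobi IHu add0r lieb_antisym [ [[u, _]] ]lieb_antisym IHv
      oppr0 lieb0r oppr0.
elim/nilp2_ind: x y z => [k||c u v IHu IHv|u v IHu IHv] y z.
- exact: genl0.
- by rewrite !lieb0l.
- by rewrite liebDl liebZl liebDl liebZl IHu IHv scaler0 addr0.
- by rewrite IHu lieb0l.
Qed.

Lemma nilp2_derived_central (d z : L) :
  d \in @derived_pred F L -> [[d, z]] = 0.
Proof.
move=> /asboolP[s ->]; rewrite lieb_suml big1_seq // => p _.
by rewrite liebZl nilp2_liebb_eq0 scaler0.
Qed.

Lemma nilp2_lieb_ab (x x' y y' : L) :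
  ab x = ab x' -> ab y = ab y' -> [[x, y]] = [[x', y']].
Proof.
move=> /ab_eq dx /ab_eq dy; apply/eqP; rewrite -subr_eq0.
have -> : [[x, y]] - [[x', y']] = [[x - x', y]] + [[x', y - y']].
  by rewrite liebBl liebBr addrA subrK.
by rewrite [ [[x', _]] ]lieb_antisym !nilp2_derived_central // subr0.
Qed.

Lemma ab_gen_span (x : L) :
  exists c : 'I_n -> F, ab x = \sum_k c k *: ab (x_ k).
Proof.
elim/nilp2_ind: x => [i||c u v [d du] [e ev]|u v _ _].
- exists (fun k => (k == i)%:R); rewrite (bigD1 i) //= eqxx scale1r.
  by rewrite big1 ?addr0 // => k /negPf->; rewrite scale0r.
- by exists (fun=> 0); rewrite ab0 big1 // => k _; rewrite scale0r.
- exists (fun k => c * d k + e k); rewrite abD abZ du ev scaler_sumr -big_split.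
  by apply: eq_bigr => k _; rewrite scalerDl scalerA.
- exists (fun=> 0); rewrite (proj2 (ab_morphism L)) ab_lieb_eq0 big1 // => k _.
  by rewrite scale0r.
Qed.

(** Both arguments may be replaced by combinations of generators with the same classes, whose
    bracket is given by [lieb_comb]. *)
Lemma derived_bracketE (x y : L) (a b : 'I_n -> F) :
  ab x = \sum_k a k *: ab (x_ k) -> ab y = \sum_k b k *: ab (x_ k) ->
  derived_bracket x y =
    \sum_(k < n) \sum_(l < n | (l < k)%N)
      (a k * b l - a l * b k) *: nilp2_z F k l.
Proof.
move=> ax bx; apply: val_inj.
rewrite [LHS](nilp2_lieb_ab (x' := \sum_k a k *: x_ k)
                            (y' := \sum_k b k *: x_ k)).
- rewrite lieb_comb raddf_sum; apply: eq_bigr => k _; rewrite raddf_sum.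
  exact: eq_bigr.
- by rewrite ax linear_sum; apply: eq_bigr => k _; rewrite linearZ.
- by rewrite bx linear_sum; apply: eq_bigr => k _; rewrite linearZ.
Qed.

(** Brackets generate the derived subalgebra, and each of them expands on these [nilp2_z]. *)
Lemma nilp2_z_eq (V : lmodType F) (f g : {linear derived L -> V}) :
  (forall k l : 'I_n, (l < k)%N -> f (nilp2_z F k l) = g (nilp2_z F k l)) ->
  f =1 g.
Proof.
move=> fg; elim/derived_bracket_ind=> [|c u v fu fv|x y].
- by rewrite !linear0.
- by rewrite !linearP fu fv.
have [a ax] := ab_gen_span x; have [b yb] := ab_gen_span y.
rewrite (derived_bracketE ax yb) !linear_sum; apply: eq_bigr => k _.
by rewrite !linear_sum; apply: eq_bigr => l lk; rewrite !linearZ fg.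
Qed.

(** The morphism [f] to the wedge model sends the bracket of generators [i] and [j] to
    [delta_mx i j - delta_mx j i], so for [l < k] the entry [(k, l)] of the image reads off one
    coefficient. *)
Lemma nilp2_z_free (c d : 'I_n -> 'I_n -> F) :
  \sum_(k < n) \sum_(l < n | (l < k)%N) c k l *: nilp2_z F k l =
    \sum_(k < n) \sum_(l < n | (l < k)%N) d k l *: nilp2_z F k l ->
  forall k l : 'I_n, (l < k)%N -> c k l = d k l.
Proof.
pose f := pres_lift (rel := @nilp2_rel F n) (@wedge_gen F n).
have [flin fbr] : lie_morphism f.
  by apply: pres_lift_morphism => t /wedge_gen_rel.
have fgen i : f (x_ i) = wedge_gen F i.
  by apply: pres_lift_gen => t /wedge_gen_rel.
pose h k l (u : derived L) : F^o := (f (val u)).2 k l.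
have hlin k l : linear (h k l) by move=> e u v; rewrite /h [f _]flin !mxE.
pose hL k l : {linear derived L -> F^o} :=
  HB.pack (h k l) (GRing.isLinear.Build F _ _ _ (h k l) (hlin k l)).
have h_z k l i j : h k l (nilp2_z F i j) =
    ((k == i) && (l == j))%:R - ((k == j) && (l == i))%:R.
  by rewrite /h [f _]fbr !fgen wedge_gen_lieb !mxE.
have coefE (e : 'I_n -> 'I_n -> F) (k l : 'I_n) : (l < k)%N ->
  hL k l (\sum_(i < n) \sum_(j < n | (j < i)%N) e i j *: nilp2_z F i j) = e k l.
  move=> lk; transitivity (\sum_(i < n) \sum_(j < n | (j < i)%N)
      e i j * ((k == i) && (l == j))%:R).
    rewrite linear_sum; apply: eq_bigr => i _; rewrite linear_sum.
    apply: eq_bigr => j ji; rewrite linearZ [hL _ _ _]h_z.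
    (* The transposed unit matrix has its entry above the diagonal, since [j < i], and so misses
       [(k, l)]. *)
    suff -> : (k == j) && (l == i) = false by rewrite subr0.
    by apply: contraTF lk => /andP[/eqP-> /eqP->]; rewrite -leqNgt ltnW.
  rewrite (bigD1 k) //= (bigD1 l) //= !eqxx mulr1 !big1 ?addr0 //.
  - by move=> i ik; rewrite big1 // => j _; rewrite eq_sym (negPf ik) mulr0.
  - by move=> j /andP[_ jl]; rewrite [l == j]eq_sym (negPf jl) mulr0.
by move=> cd k l lk; rewrite -(coefE c) // cd coefE.
Qed.

End FreeNilpotent.

(** * Inducible pairs and minors *)

Theorem theorem4p1 (F : fieldType) (n : nat) (n_ge2 : (2 <= n)%N)
    (theta : lieAut (derived (freeNilLie2 F n)))
    (phi : lieAut (abelianization (freeNilLie2 F n)))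
    (b : 'I_n -> 'I_n -> 'I_n -> 'I_n -> F) (a : 'M[F]_n)
    (theta_b : derived_matrix theta b) (phi_a : ab_matrix phi a) :
  inducible theta phi <->
  (forall i j k l : 'I_n, (j < i)%N -> (l < k)%N ->
     a i k * a j l - a i l * a j k = b i j k l).
Proof.
set L := freeNilLie2 F n.
split=> [ [gamma [_ gammaz gammaab] ] i j k l ji lk | ab_b].
  (* Minors and entries of [b] are both coordinates of the image under [theta] of
     [nilp2_z F i j]. *)
  apply: (nilp2_z_free (c := fun k l => a i k * a j l - a i l * a j k)) (lk).
  rewrite -(theta_b i j ji).
  have gen_ab m : ab (gamma (nilp2_gen F m)) =
      \sum_k a m k *: ab (nilp2_gen F k) by rewrite gammaab phi_a.
  rewrite -(derived_bracketE (gen_ab i) (gen_ab j)); apply: val_inj.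
  by rewrite -gammaz /= (proj2 (lieAut_morphism gamma)).
have [ [thlin _] [th' thK th'K] ] := (lieAut_morphism theta, lieAut_bij theta).
have [ [philin phibr] [ph' phK ph'K] ] := (lieAut_morphism phi, lieAut_bij phi).
pose y i : L := \sum_k a i k *: nilp2_gen F k.
have y_rel t : nilp2_rel t -> term_eval y t = 0.
  by case=> i [j [k ->] ]; apply: nilp2_liebb_eq0.
pose g : L -> L := pres_lift y.
have g_mor : lie_morphism g by apply: pres_lift_morphism.
have [glin gbr] := g_mor.
pose gL : {linear L -> L} := HB.pack g (GRing.isLinear.Build F L L _ g glin).
pose thL : {linear derived L -> derived L} :=
  HB.pack (theta : _ -> _) (GRing.isLinear.Build F _ _ _ (theta : _ -> _) thlin).
have ab_y i : ab (y i) = phi (ab (nilp2_gen F i)).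
  by rewrite phi_a linear_sum; apply: eq_bigr => k _; rewrite linearZ.
(* Both sides are Lie morphisms to the abelianization with the same values on generators, so both
   equal the lift of these values. *)
have gab x : ab (g x) = phi (ab x).
  have abrel t : nilp2_rel t -> term_eval (fun i => ab (y i)) t = 0.
    by case=> i [j [k ->] ]; apply: ab_lieb_eq0.
  have [ablin abbr] := ab_morphism L.
  transitivity (pres_lift (fun i => ab (y i)) x).
    apply: (pres_lift_unique abrel (f := fun x => ab (g x))) => [|i].
      by split=> [c u v|u v]; rewrite ?glin ?ablin ?gbr ?abbr.
    by congr ab; apply: pres_lift_gen.
  apply/esym/(pres_lift_unique abrel (f := fun x => phi (ab x))) => [|i].
    by split=> [c u v|u v]; rewrite ?ablin ?philin ?abbr ?phibr.
  by rewrite ab_y.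
have gz u : g (val u) = val (theta u).
  apply: (nilp2_z_eq (f := gL \o val) (g := val \o thL)) => i j ji /=.
  rewrite [theta _]theta_b // [LHS]gbr.
  have ab_gen m : ab (g (nilp2_gen F m)) = \sum_k a m k *: ab (nilp2_gen F k).
    by rewrite gab phi_a.
  rewrite -[LHS]/(val (derived_bracket _ _)).
  rewrite (derived_bracketE (ab_gen i) (ab_gen j)).
  congr val; apply: eq_bigr => k _; apply: eq_bigr => l lk.
  by rewrite ab_b.
have derivedP x : x \in @derived_pred F L -> exists u : derived L, x = val u.
  by move=> dx; exists (Derived dx).
(* Injectivity of [phi] puts [u - v] in the derived subalgebra, where [g] acts as the injective
   [theta]. *)
have g_inj : injective g.
  move=> u v guv; apply/eqP; rewrite -subr_eq0.
  have [|w def_w] := derivedP (u - v).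
    by apply/ab_eq/(can_inj phK); rewrite -!gab guv.
  have : g (u - v) = 0 by rewrite [LHS](linearB gL) /= guv subrr.
  rewrite def_w gz -(linear0 (val : derived L -> L)) => /val_inj tw.
  by rewrite (can_inj thK (etrans tw (esym (linear0 thL)))).
(* Inverting [phi] gives a preimage [u0] modulo the derived subalgebra; the error is corrected by
   inverting [theta]. *)
have g_surj x : exists u, g u = x.
  pose u0 := ab_repr (ph' (ab x)).
  have [|w def_w] := derivedP (x - g u0).
    by apply/ab_eq; rewrite gab ab_reprK ph'K.
  exists (u0 + val (th' w)); rewrite [LHS](linearD gL) /= gz th'K -def_w.
  by rewrite addrC subrK.
(* The chosen right inverse is two-sided because [g] is injective. *)
have [g' g'K] := choice g_surj.
have g_bij : bijective g.
  by exists g' => // u; apply: g_inj; rewrite g'K.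
exists (LieAut g_mor g_bij); split=> //= x; split=> [|[u du <-] ].
  move=> /derivedP[u ->]; exists (val (th' u)); first exact: valP.
  by rewrite gz th'K.
by have [w ->] := derivedP u du; rewrite gz; apply: valP.
Qed.
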